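(* Let $n\ge1$ and let $X$ be an absolutely continuous random variable with finite support $[0,b]$, $b>0$, and cdf $F$. Then there is a constant $k$ such that $$\frac{d}{dt}\,\overline\varepsilon J(X_{n:n};t)=k\qquad\text{for all } t\in(0,b)$$ if and only if $X$ has a power distribution, i.e. $F(x)=(x/b)^c$ for $0<x<b$ for some $c>0$.
   Context: Having support $[0,b]$ means that the smallest closed set carrying the distribution has left endpoint $0$ and right endpoint $b$; in particular $F(t)>0$ for $t>0$. $X_{n:n}$ is the maximum of $n$ i.i.d. copies of $X$ (with cdf $F^n$). The dynamic cumulative past extropy of $X_{n:n}$ is $$\overline\varepsilon J(X_{n:n};t)=-\frac12\int_0^t\left(\frac{F(x)}{F(t)}\right)^{2n}dx .$$ *)

(* Defs.v *)
From mathcomp Require Import all_boot all_order all_algebra.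
From mathcomp Require Import all_classical all_reals all_analysis.
Import Order.TTheory GRing.Theory Num.Theory numFieldNormedType.Exports.

Set Implicit Arguments.
Unset Strict Implicit.
Unset Printing Implicit Defensive.

Local Open Scope classical_set_scope.
Local Open Scope ring_scope.

Definition carries (R : realType) (mu : set R -> \bar R) (C : set R) : Prop :=
  mu (~` C) = 0%E.

Definition is_support (R : realType) (mu : set R -> \bar R) (S : set R) : Prop :=
  [/\ closed S, carries mu S &
      forall C : set R, closed C -> carries mu C -> S `<=` C].

(* The support has least element a and greatest element b; it is not required
   to be the whole interval. *)
Definition has_support_endpoints (R : realType) (mu : set R -> \bar R)
    (a b : R) : Prop :=
  exists S : set R, [/\ is_support mu S, S `<=` `[a, b], S a & S b].

Definition abs_continuous d (T : measurableType d) (R : realType)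
    (P : probability T R) (X : {RV P >-> R}) : Prop :=
  distribution P X `<< (@lebesgue_measure R).

Definition cdfR d (T : measurableType d) (R : realType)
    (P : probability T R) (X : {RV P >-> R}) (x : R) : R :=
  fine (cdf X x).

(* F is the common cdf of the n i.i.d. copies whose maximum is X_{n:n}, which
   therefore has cdf F ^+ n; the past extropy squares the cdf ratio, hence the
   exponent 2n. *)
Definition past_extropy_max (R : realType) (n : nat) (F : R -> R) (t : R) : R :=
  - (2^-1 * \int[lebesgue_measure]_(x in `[0, t]) ((F x / F t) ^+ (2 * n)%N)).

Definition is_power_cdf (R : realType) (b : R) (F : R -> R) : Prop :=
  exists2 c : R, 0 < c & forall x : R, 0 < x < b -> F x = (x / b) `^ c.

(* Main.v *)
(** Write [m = 2 n] and [G t] for the integral of [F ^+ m] over [[0, t]], so that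
the extropy is [- G / (2 G')].  If its derivative is the constant [k], then
[G = - 2 k t G'] on [(0, b]], with no additive constant because [0 <= G t <= t G' t].
This Euler equation makes [G t * t `^ (- a^-1)] constant for [a = - 2 k > 0], hence
[F t ^+ m = (t / b) `^ (a^-1 - 1)]; the exponent is positive since [F] is
continuous and vanishes at [0].  Conversely a power cdf gives [G] explicitly. *)
Require Import Defs.
From mathcomp Require Import all_boot all_order all_algebra.
From mathcomp Require Import all_classical all_reals all_analysis.
From mathcomp Require Import ring lra.
Import Order.TTheory GRing.Theory Num.Theory numFieldNormedType.Exports.
Set Implicit Arguments.
Unset Strict Implicit.
Local Open Scope classical_set_scope.
Local Open Scope ring_scope.

(** * Regularity of the cdf of an absolutely continuous law, and its values at the support
    endpoints *)

Section cdf.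
Context (R : realType) (d : measure_display) (T : measurableType d)
  (P : probability T R) (X : {RV P >-> R}).
Local Notation F := (cdfR X).
Local Notation mu := (distribution P X).

Lemma cdfRE t : (F t)%:E = cdf X t.
Proof. by rewrite /cdfR fineK// fin_num_measure. Qed.

Lemma cdfR_nondecreasing : {homo F : x y / x <= y}.
Proof. by move=> x y xy; rewrite -lee_fin !cdfRE; exact: cdf_nondecreasing. Qed.

Lemma cdfR_ge0 t : 0 <= F t.
Proof. by rewrite -lee_fin cdfRE cdf_ge0. Qed.

(** The singleton [[set a]] is Lebesgue-null, so absolute continuity forbids an atom at [a]. *)
Lemma cdf_open_ray a : abs_continuous X -> mu `]-oo, a[ = cdf X a.
Proof.
move=> hac; have mua : mu [set a] = 0%E.
  have /null_content_dominatesP/(_ [set a]) := hac.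
  by apply; [exact: measurable_set1|exact: lebesgue_measure_set1].
rewrite /cdf -(@setUitv1 _ _ -oo%O a true) ?bnd_simp//.
rewrite measureU//=; last first.
  apply/seteqP; split => x //=; rewrite in_itv/= => -[+ xE].
  by rewrite xE ltxx.
by rewrite mua adde0.
Qed.

(** Every cdf is right continuous. On the left, continuity of the measure from below along rays
    increasing to the open ray gives the limit, which is [F a] for lack of an atom. *)
Lemma cdfR_continuous : abs_continuous X -> continuous F.
Proof.
move=> hac a; apply/left_right_continuousP; split; last first.
  by apply: fine_cvg; rewrite cdfRE; exact: cdf_right_continuous.
pose G n : set R := `]-oo, a - n.+1%:R^-1]%classic.
have UG : \bigcup_n G n = `]-oo, a[%classic.
  apply/seteqP; split => x /=.
    move=> [n _ /=]; rewrite /G/= !in_itv/= => /le_lt_trans; apply.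
    by rewrite gtrBl invr_gt0.
  rewrite in_itv/= => xa; exists (Num.truncn (a - x)^-1) => //=.
  rewrite /G/= in_itv/= lerBrDl addrC -lerBrDl -[leRHS]invrK.
  by rewrite lef_pV2 ?posrE ?ltr0n// ?invr_gt0 ?subr_gt0// ltW// Num.Theory.truncnS_gt.
have FG : F (a - n.+1%:R^-1) @[n --> \oo] --> F a.
  apply: fine_cvg; rewrite cdfRE -cdf_open_ray// -UG.
  apply: nondecreasing_cvg_mu => //; first by rewrite UG.
  move=> m n mn; apply/subsetPset; apply: subset_itvl.
  by rewrite bnd_simp lerD2l lerN2 lef_pV2 ?posrE// ler_nat.
apply/cvgrPdist_lt => e e0.
have [N _ /(_ N (leqnn N)) /=] := (cvgrPdist_lt _ _).1 FG e e0.
(* Monotonicity passes from the sequence to all [y] close to [a] on the left: [F y] lies between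
   [F (a - N.+1%:R^-1)] and [F a]. *)
move=> FN; near=> y.
have ya : y <= a by near: y; exact: nbhs_left_le.
have Ny : a - N.+1%:R^-1 <= y.
  by near: y; apply: nbhs_left_ge; rewrite gtrBl invr_gt0.
have h1 := cdfR_nondecreasing ya; have h2 := cdfR_nondecreasing Ny.
apply: le_lt_trans FN.
by rewrite !ger0_norm ?subr_ge0 ?(le_trans h2)// lerD2l lerN2.
Unshelve. all: by end_near. Qed.

Lemma cdfR_left_endpoint a b : abs_continuous X ->
  has_support_endpoints mu a b -> F a = 0.
Proof.
move=> hac [S [[cS S0 _] Sab _ _]].
apply: EFin_inj; rewrite cdfRE -cdf_open_ray//.
apply: (subset_measure0 _ _ _ S0) => //.
  by apply: measurableC; exact: measurable_realfun.closed_measurable.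
move=> x /=; rewrite in_itv/= => xa /Sab/=.
by rewrite in_itv/= leNgt xa.
Qed.

Lemma cdfR_right_endpoint a b : has_support_endpoints mu a b -> F b = 1.
Proof.
move=> [S [[cS S0 _] Sab _ _]].
apply: EFin_inj; rewrite cdfRE cdf_1_ccdf /ccdf.
rewrite (_ : mu _ = 0%E) ?sube0//.
apply: (subset_measure0 _ _ _ S0) => //.
  by apply: measurableC; exact: measurable_realfun.closed_measurable.
move=> x /=; rewrite in_itv/= andbT => xa /Sab/=.
by rewrite in_itv/= => /andP[_]; rewrite leNgt xa.
Qed.

(** If [F t] were 0, the closed ray from [t] would carry the law and so, by minimality, contain the
    support, although [a < t] belongs to it. *)
Lemma cdfR_gt0 a b t : has_support_endpoints mu a b -> a < t -> 0 < F t.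
Proof.
move=> [S [[_ _ Smin] _ Sa _]] at'.
rewrite lt0r cdfR_ge0 andbT; apply/eqP => Ft0.
have /(_ a Sa)/= : S `<=` `[t, +oo[%classic.
  apply: Smin; rewrite /carries; first exact: rray_closed.
  rewrite setCitvr.
  apply: (@subset_measure0 _ _ _ mu _ `]-oo, t]%classic) => //.
    by move=> x /=; rewrite !in_itv/=; exact: ltW.
  by rewrite -[LHS]/(cdf X t) -cdfRE Ft0.
by rewrite in_itv/= andbT leNgt at'.
Qed.
End cdf.

(** * Functions with zero derivative on a half-open interval *)

Section analysis.
Context (R : realType).
Implicit Types (f F : R -> R) (b t : R) (m : nat).

Lemma is_derive_continuous f t df : is_derive t 1 f df -> {for t, continuous f}.
Proof. by case=> /derivable1_diffP/differentiable_continuous. Qed.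

Lemma is_derive_mulr (k t : R) : is_derive t 1 (fun s => k * s) k.
Proof.
rewrite -[X in is_derive _ _ _ X]mulr1.
exact: (is_deriveZ k (is_derive_id t (1 : R))).
Qed.

(** Mean value theorem on [[t, b]]. The point 0 is left out because negative powers of [t] and
    division by [F t] degenerate there. *)
Lemma is_derive0_oc_cst f b :
  (forall t, 0 < t <= b -> {for t, continuous f}) ->
  (forall t, 0 < t < b -> is_derive t 1 f 0) ->
  forall t, 0 < t <= b -> f t = f b.
Proof.
move=> cf df t /andP[t0 tb]; apply/esym/eqP; rewrite -subr_eq0; apply/eqP.
have [||c _ ->] := @MVT_segment R f (fun=> 0) t b tb; last by rewrite mul0r.
- by move=> x; rewrite in_itv/= => /andP[tx xb]; apply: df; rewrite xb (lt_trans t0).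
- apply: continuous_in_subspaceT => x; rewrite inE/= in_itv/= => /andP[tx xb].
  by apply: cf; rewrite xb (lt_le_trans t0).
Qed.

(** The linear bound replaces an initial condition at 0: it makes the constant value of [f]
    arbitrarily small. *)
Lemma is_derive0_oc_eq0 f b M :
  (forall t, 0 < t <= b -> {for t, continuous f}) ->
  (forall t, 0 < t < b -> is_derive t 1 f 0) ->
  (forall t, 0 < t <= b -> `|f t| <= M * t) ->
  forall t, 0 < t <= b -> f t = 0.
Proof.
move=> cf df bf t t0b.
have cst := is_derive0_oc_cst cf df; rewrite (cst t t0b).
have b0 : 0 < b by case/andP: t0b => /lt_le_trans; apply.
apply/eqP; rewrite -normr_le0; apply/ler_addgt0Pr => e e0; rewrite add0r.
(* Adding 1 keeps the divisor in the choice of [s] positive even if [M] is 0. *)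
have M1 : 0 < `|M| + 1 by rewrite ltr_wpDl.
have [s [s0 sb se]] : exists s, [/\ 0 < s, s <= b & (`|M| + 1) * s <= e].
  exists (Num.min b (e / (`|M| + 1))); split.
  - by rewrite lt_min b0 divr_gt0.
  - by rewrite ge_min lexx.
  - by rewrite mulrC -ler_pdivlMr// ge_min lexx orbT.
have s0b : 0 < s <= b by rewrite s0.
rewrite -(cst s s0b) (le_trans (bf s s0b))// (le_trans _ se)//.
by rewrite ler_wpM2r ?(ltW s0)// (le_trans (ler_norm _))// lerDl.
Qed.

Lemma powR_div (x y r : R) : 0 <= x -> 0 <= y -> (x / y) `^ r = x `^ r * y `^ (- r).
Proof.
move=> x0 y0; rewrite powRM ?invr_ge0// -(powR_inv1 y0) -powRrM.
by rewrite mulN1r.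
Qed.

(** * The integral of a power of a continuous nondecreasing function *)

Section cumulative_power.
Context (F : R -> R) (m : nat).
Hypotheses (Fge0 : forall t, 0 <= F t) (Fnd : {homo F : x y / x <= y})
  (Fcont : continuous F).
Local Notation G := (fun t => \int[lebesgue_measure]_(x in `[0, t]) (F x ^+ m)).

Lemma continuousX_cumulative : continuous (fun x => F x ^+ m).
Proof.
move=> x; elim: m => [|k IH].
  by under eq_fun do rewrite expr0; exact: cvg_cst.
by under eq_fun do rewrite exprS; apply: cvgM => //; exact: Fcont.
Qed.

Lemma integrableX_cumulative t :
  lebesgue_measure.-integrable `[0, t] (EFin \o (fun x => F x ^+ m)).
Proof.
apply: continuous_compact_integrable; first exact: segment_compact.
apply: continuous_subspaceT; exact: continuousX_cumulative.
Qed.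

Lemma is_derive_integralX t : 0 < t -> is_derive t 1 G (F t ^+ m).
Proof.
move=> t0.
(* The upper bound [t + 1] makes [t] an interior point of the interval of integration. *)
have [||||dG eG] := @continuous_FTC1_closed R (fun x => F x ^+ m) 0 t (t + 1).
- by rewrite ltrDl.
- exact: integrableX_cumulative.
- exact: t0.
- exact: continuousX_cumulative.
by split; [exact: dG|rewrite -derive1E; exact: eG].
Qed.

Lemma integralX_ge0 t : 0 <= G t.
Proof. by apply: Rintegral_ge0 => x _; rewrite exprn_ge0. Qed.

Lemma integralX_le t : 0 <= t -> G t <= t * F t ^+ m.
Proof.
move=> t0; apply: (@le_trans _ _ (\int[lebesgue_measure]_(x in `[0, t]) (F t ^+ m))).
  apply: le_Rintegral => //.
  - exact: integrableX_cumulative.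
  - apply: continuous_compact_integrable; first exact: segment_compact.
    by apply: continuous_subspaceT => x; exact: cvg_cst.
  - move=> x /=; rewrite in_itv/= => /andP[_ xt].
    by rewrite lerXn2r ?nnegrE// Fnd.
rewrite Rintegral_cst//= lebesgue_measure_itv/= lte_fin.
case: ifPn => [|]; last by rewrite -leNgt => ?; rewrite mulr0 mulr_ge0// exprn_ge0.
by rewrite sube0/= mulrC.
Qed.
End cumulative_power.

Lemma past_extropy_maxE n F t : continuous F ->
  past_extropy_max n F t =
  - (2^-1 * (\int[lebesgue_measure]_(x in `[0, t]) (F x ^+ (2 * n)) / F t ^+ (2 * n))).
Proof.
move=> cF; rewrite /past_extropy_max; congr (- (_ * _)).
rewrite [RHS]mulrC -RintegralZl//; last exact: integrableX_cumulative.
by apply: eq_Rintegral => x _; rewrite expr_div_n mulrC.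
Qed.

(** * Constant derivative of the extropy against power cdfs *)

Section extropy.
Context (n : nat) (F : R -> R) (b : R).
Hypotheses (n0 : (0 < n)%N) (b0 : 0 < b).
Hypotheses (Fge0 : forall t, 0 <= F t) (Fnd : {homo F : x y / x <= y})
  (Fcont : continuous F).
Hypotheses (F0 : F 0 = 0) (Fb : F b = 1) (Fgt0 : forall t, 0 < t -> 0 < F t).
Local Notation m := (2 * n)%N.
Local Notation G := (fun t => \int[lebesgue_measure]_(x in `[0, t]) (F x ^+ m)).

Let FXgt0 t : 0 < t -> 0 < F t ^+ m.
Proof. by move=> /Fgt0 ?; rewrite exprn_gt0. Qed.

Lemma past_extropy_max_continuous t : 0 < t ->
  {for t, continuous (past_extropy_max n F)}.
Proof.
move=> t0; rewrite (_ : past_extropy_max n F = fun t => - (2^-1 * (G t / F t ^+ m))).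
  apply: cvgN; apply: cvgM; first exact: cvg_cst.
  apply: cvgM; first exact: is_derive_continuous (is_derive_integralX m Fcont t0).
  by apply: cvgV; [rewrite gt_eqF ?FXgt0|exact: continuousX_cumulative].
by apply/funext => s; rewrite past_extropy_maxE.
Qed.

(** Supplies the linear bound that fixes the integration constant at 0. *)
Lemma past_extropy_max_le t : 0 < t -> `|past_extropy_max n F t| <= 2^-1 * t.
Proof.
move=> t0; rewrite past_extropy_maxE// normrN normrM ger0_norm ?invr_ge0//.
rewrite ler_wpM2l ?invr_ge0// ger0_norm; last first.
  by rewrite divr_ge0 ?exprn_ge0// integralX_ge0.
by rewrite ler_pdivrMr ?FXgt0// integralX_le// ltW.
Qed.

Lemma cst_derive_past_extropy_integral k :
  (forall t, 0 < t < b -> is_derive t 1 (past_extropy_max n F) k) ->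
  forall t, 0 < t <= b -> G t = - (2 * k) * t * F t ^+ m.
Proof.
move=> dk t tb; have t0 : 0 < t by case/andP: tb.
have : past_extropy_max n F t - k * t = 0.
  apply: (@is_derive0_oc_eq0 (fun t => past_extropy_max n F t - k * t)
    b (2^-1 + `|k|)) tb.
  - move=> s /andP[s0 _]; apply: cvgB; first exact: past_extropy_max_continuous.
    by apply: cvgM; [exact: cvg_cst|exact: cvg_id].
  - move=> s /dk dks.
    by rewrite -(subrr k); exact: is_deriveB (is_derive_mulr k s).
  - move=> s /andP[s0 _]; rewrite (le_trans (ler_normB _ _))// mulrDl lerD//.
      exact: past_extropy_max_le.
    by rewrite normrM (gtr0_norm s0).
rewrite past_extropy_maxE// => e.
have FX0 := FXgt0 t0; have FXn0 : F t ^+ m != 0 by rewrite gt_eqF.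
apply: (mulIf (invr_neq0 FXn0)); rewrite mulfK//.
by set q := (X in - (_ * X)) in e; rewrite -/q; lra.
Qed.

(** At [b] the integral equals [- (2 * k) * b], so its sign excludes [k > 0]. If [k = 0], then [G]
    vanishes on [(0, b]], against its positive derivative at [b / 2]. *)
Lemma cst_derive_past_extropy_lt0 k :
  (forall t, 0 < t < b -> is_derive t 1 (past_extropy_max n F) k) -> k < 0.
Proof.
move=> dk; have GE := cst_derive_past_extropy_integral dk.
have b20 : 0 < b / 2 by rewrite divr_gt0.
have b2b : b / 2 < b by lra.
rewrite lt_neqAle; apply/andP; split; last first.
  have := integralX_ge0 m Fge0 b; rewrite GE ?b0 ?lexx// Fb expr1n mulr1.
  by rewrite pmulr_lge0//; lra.
apply/eqP => k0.
have dG := is_derive_integralX m Fcont b20.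
have dG0 : is_derive (b / 2) 1 G 0.
  apply: (@near_eq_is_derive _ _ _ (cst 0)).
  near=> s; rewrite GE ?k0 ?mulr0 ?oppr0 ?mul0r//; apply/andP; split.
    by near: s; exact: lt_nbhsr.
  by apply: ltW; near: s; exact: lt_nbhsl.
have := FXgt0 b20.
by rewrite -(@derive_val _ _ _ _ _ _ _ dG) (@derive_val _ _ _ _ _ _ _ dG0) ltxx.
Unshelve. all: by end_near. Qed.

Lemma cst_derive_past_extropy_power k :
  (forall t, 0 < t < b -> is_derive t 1 (past_extropy_max n F) k) ->
  is_power_cdf b F.
Proof.
move=> dk; have k0 := cst_derive_past_extropy_lt0 dk.
have := cst_derive_past_extropy_integral dk.
set a := - (2 * k) => GE; have a0 : 0 < a by rewrite /a; lra.
(* The Euler equation yields [F t ^+ m] as a power with exponent [a^-1 - 1]; [c] is the exponent of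
   its [m]-th root. *)
pose c : R := (a^-1 - 1) / m%:R.
have m0 : 0 < m%:R :> R by rewrite ltr0n muln_gt0.
have FE t : 0 < t < b -> F t = (t / b) `^ c.
  move=> /andP[t0 tb]; have tb0 : 0 < t / b by rewrite divr_gt0.
  apply/eqP; rewrite -(@eqrXn2 _ m) ?powR_ge0 ?muln_gt0//.
  rewrite -[X in _ == X]powR_mulrn ?powR_ge0// -powRrM /c divfK ?lt0r_neq0//.
  (* With [G = a * t * G'], the two terms of the product rule cancel. *)
  have : G t * t `^ (- a^-1) = G b * b `^ (- a^-1).
    apply: (@is_derive0_oc_cst (fun t => G t * t `^ (- a^-1))); last by rewrite t0 ltW.
    - move=> s /andP[s0 _]; apply: cvgM.
        exact: is_derive_continuous (is_derive_integralX m Fcont s0).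
      exact: is_derive_continuous (is_derive1_powR _ s0).
    - move=> s /andP[s0 sb].
      have := is_deriveM (is_derive_integralX m Fcont s0) (is_derive1_powR (- a^-1) s0).
      move=> h; apply: (is_derive_eq h); rewrite /GRing.scale/= GE ?s0 ?ltW//.
      rewrite [in X in X + _]powRB; last by rewrite (gt_eqF s0) implybT.
      rewrite powRr1 ?(ltW s0)//; field.
      by rewrite !gt_eqF.
  rewrite !GE ?t0 ?b0 ?lexx ?ltW// Fb expr1n mulr1 => e.
  have bp : b `^ (a^-1) != 0 by rewrite gt_eqF ?powR_gt0.
  have tp : t `^ (a^-1) != 0 by rewrite gt_eqF ?powR_gt0.
  apply/eqP; rewrite powRB; last by rewrite (gt_eqF tb0) implybT.
  rewrite powRr1 ?(ltW tb0)// powR_div ?(ltW t0) ?(ltW b0)// !powRN.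
  rewrite !powRN in e.
  have t1 : t != 0 by rewrite gt_eqF.
  have b1 : b != 0 by rewrite gt_eqF.
  have a1 : a != 0 by rewrite gt_eqF.
  have -> : F t ^+ m = (a * t * F t ^+ m / t `^ a^-1) * (t `^ a^-1 / (a * t)).
    by field; rewrite a1 t1 tp.
  by rewrite e; field; rewrite a1 b1 t1 bp.
exists c => //; rewrite ltNge; apply/negP => c0.
have : \forall t \near (0 : R)^'+, `|F 0 - F t| < 1.
  by have /cvg_at_right_filter/cvgrPdist_lt := @Fcont 0; apply.
move=> near0; suff : \forall t \near (0 : R)^'+, False by move=> /filter_ex[].
near=> t.
have t0 : 0 < t by near: t; exact: nbhs_right_gt.
have tb : t < b by near: t; exact: nbhs_right_lt.
have : `|F 0 - F t| < 1 by near: t.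
rewrite F0 sub0r normrN ger0_norm// FE ?t0// ltNge => /negP; apply.
rewrite -[leLHS](powRr0 (t / b)); apply: ger_powR => //.
by rewrite divr_gt0//= ler_pdivrMr// mul1r ltW.
Unshelve. all: by end_near. Qed.

(** For a power cdf, [G] is the explicit antiderivative [H], and the extropy on [(0, b)] is linear
    in [t]. *)
Lemma power_derive_past_extropy_cst : is_power_cdf b F ->
  exists k, forall t, 0 < t < b -> is_derive t 1 (past_extropy_max n F) k.
Proof.
move=> [c c0 FE]; pose p := c * m%:R.
have p0 : 0 <= p by rewrite mulr_ge0// ltW.
have p1 : 0 < p + 1 by lra.
have FXE t : 0 < t < b -> F t ^+ m = (t / b) `^ p.
  by move=> /FE ->; rewrite -powR_mulrn ?powR_ge0// -powRrM.
pose H t := (p + 1)^-1 * b `^ (- p) * t `^ (p + 1).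
have HE t : 0 < t -> H t = (p + 1)^-1 * t * (t / b) `^ p.
  move=> t0; rewrite /H powRD; last by rewrite (gt_eqF t0) implybT.
  rewrite powRr1 ?(ltW t0)// powR_div ?(ltW t0) ?(ltW b0)//; ring.
have dH t : 0 < t -> is_derive t 1 H ((t / b) `^ p).
  move=> t0; have := is_deriveZ ((p + 1)^-1 * b `^ (- p)) (is_derive1_powR (p + 1) t0).
  move=> h; apply: (is_derive_eq h); rewrite /GRing.scale/= addrK.
  rewrite powR_div ?(ltW t0) ?(ltW b0)//; field.
  by rewrite gt_eqF.
have GH t : 0 < t <= b -> G t = H t.
  move=> tb; apply/eqP; rewrite -subr_eq0; apply/eqP.
  (* The constant 2 adds the bounds [G s <= s], from [F <= 1], and [H s <= s], from [p >= 0] and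
     [s <= b]. *)
  apply: (@is_derive0_oc_eq0 (fun t => G t - H t) b 2) tb.
  - move=> s /andP[s0 _]; apply: cvgB.
      exact: is_derive_continuous (is_derive_integralX m Fcont s0).
    exact: is_derive_continuous (dH _ s0).
  - move=> s sb; have s0 : 0 < s by case/andP: sb.
    rewrite -[X in is_derive _ _ _ X](subrr (F s ^+ m)); apply: is_deriveB.
      exact: is_derive_integralX.
    by rewrite FXE//; exact: dH.
  - move=> s /andP[s0 sb]; rewrite (le_trans (ler_normB _ _))// mulr_natl mulr2n lerD//.
      rewrite ger0_norm ?integralX_ge0//.
      rewrite (le_trans (integralX_le m Fge0 Fnd Fcont (ltW s0)))//.
      by rewrite ler_piMr ?(ltW s0)// exprn_ile1// -Fb Fnd.
    rewrite HE// ger0_norm; last first.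
      by rewrite !mulr_ge0 ?powR_ge0 ?invr_ge0 ?(ltW s0) ?(ltW p1).
    rewrite -mulrA mulrCA ler_piMr ?(ltW s0)// mulr_ile1 ?powR_ge0 ?invr_ge0 ?(ltW p1)//.
      by rewrite invf_le1//; lra.
    rewrite -[leRHS](powRr0 (s / b)); apply: ger_powR => //.
    by rewrite divr_gt0//= ler_pdivrMr// mul1r.
exists (- (2^-1 * (p + 1)^-1)) => t /andP[t0 tb].
(* The linear formula holds only inside [(0, b)], so the derivative is transferred by equality near
   [t]. *)
apply: (@near_eq_is_derive _ _ _ (fun t => - (2^-1 * (p + 1)^-1) * t)).
  near=> s.
  have s0 : 0 < s by near: s; exact: lt_nbhsr.
  have sb : s < b by near: s; exact: lt_nbhsl.
  rewrite past_extropy_maxE// GH ?s0 ?ltW// HE// FXE ?s0//; field.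
  by rewrite !gt_eqF ?powR_gt0 ?divr_gt0.
exact: is_derive_mulr.
Unshelve. all: by end_near. Qed.
End extropy.
End analysis.
Unset Implicit Arguments.

Theorem corollary3p1 (R : realType) (d : measure_display)
    (T : measurableType d) (P : probability T R) (X : {RV P >-> R})
    (n : nat) (b : R) (hn : (1 <= n)%N) (hb : 0 < b)
    (hac : abs_continuous X)
    (hsupp : has_support_endpoints (distribution P X) 0 b) :
  (exists k : R, forall t : R, 0 < t < b ->
     is_derive t 1 (past_extropy_max n (cdfR X)) k)
  <-> is_power_cdf b (cdfR X).
Proof.
(* The analytic part sees the law of [X] only through these six facts on its cdf. *)
have F0 := cdfR_left_endpoint hac hsupp.
have Fb := cdfR_right_endpoint hsupp.
have Fgt0 t := @cdfR_gt0 _ _ _ _ X 0 b t hsupp.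
have Fcont := cdfR_continuous hac.
have Fge0 := cdfR_ge0 X; have Fnd := @cdfR_nondecreasing _ _ _ _ X.
split=> [[k dk]|]; last exact: power_derive_past_extropy_cst.
exact: cst_derive_past_extropy_power hn hb Fge0 Fnd Fcont F0 Fb Fgt0 k dk.
Qed.
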